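(* Let $\mathcal{A}$ be a unital $C^*$-algebra, $\mathcal{H}$ a Hilbert $\mathcal{A}$-module, and $\mathbb{J}\subseteq\mathbb{N}$ a finite or countable index set. Let $\{T_i\}_{i\in\mathbb{J}}$ be an operator frame for $End_{\mathcal{A}}^{*}(\mathcal{H})$ with bounds $A$ and $B$, and let $\{R_i\}_{i\in\mathbb{J}}\subset End_{\mathcal{A}}^{*}(\mathcal{H})$. Then the following statements are equivalent: (i) $\{R_i\}_{i\in\mathbb{J}}$ is an operator frame for $End_{\mathcal{A}}^{*}(\mathcal{H})$. (ii) There exists a constant $M>0$ such that for all $x\in\mathcal{H}$, $$\Big\|\sum_{i\in\mathbb{J}}\langle(T_i-R_i)x,(T_i-R_i)x\rangle\Big\|\le M\min\Big(\Big\|\sum_{i\in\mathbb{J}}\langle T_ix,T_ix\rangle\Big\|,\Big\|\sum_{i\in\mathbb{J}}\langle R_ix,R_ix\rangle\Big\|\Big).$$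
   Context: Hilbert $\mathcal{A}$-modules are left modules with $\mathcal{A}$-valued inner product $\langle\cdot,\cdot\rangle$, $\mathcal{A}$-linear in the first variable, with $\langle x,y\rangle=\langle y,x\rangle^*$, complete for $\|x\|=\|\langle x,x\rangle\|^{1/2}$. $End_{\mathcal{A}}^{*}(\mathcal{H})$ is the set of adjointable operators on $\mathcal{H}$. Inequalities between elements of $\mathcal{A}$ refer to the usual order given by the positive cone of $\mathcal{A}$. A family $\{T_i\}_{i\in\mathbb{J}}\subset End_{\mathcal{A}}^{*}(\mathcal{H})$ is an operator frame for $End_{\mathcal{A}}^{*}(\mathcal{H})$ with (lower and upper) bounds $A,B>0$ if $A\langle x,x\rangle\le\sum_{i\in\mathbb{J}}\langle T_ix,T_ix\rangle\le B\langle x,x\rangle$ for all $x\in\mathcal{H}$; it is an operator frame if such constants exist. Convention: all series of the form $\sum_{i\in\mathbb{J}}\langle T_ix,T_ix\rangle$ are taken to converge in norm in $\mathcal{A}$ (i.e. $\{T_ix\}_{i\in\mathbb{J}}\in\ell^2(\mathcal{H})$, the Hilbert $\mathcal{A}$-module of sequences $\{x_i\}$ in $\mathcal{H}$ with $\sum_i\langle x_i,x_i\rangle$ norm convergent); this convergence is part of the notion of operator frame, and an inequality involving such series includes the assertion that the series appearing in it converge in norm. *)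

(* Defs.v *)
From HB Require Import structures.
From mathcomp Require Import all_boot all_order all_algebra.
From mathcomp Require Import all_classical all_reals all_analysis.
From mathcomp Require Export complex.

Set Implicit Arguments.
Unset Strict Implicit.
Unset Printing Implicit Defensive.

Import Order.TTheory GRing.Theory Num.Theory.
Import numFieldNormedType.Exports.
Local Open Scope classical_set_scope.
Local Open Scope ring_scope.

(* Unital C*-algebras, the zero algebra included.  The product is a field of
   the mixin because Hierarchy Builder has no join of rings and normed modules
   below [numDomainType], whose product is commutative. *)
HB.mixin Record isCStarAlgebra (R : realType) A
    of CompleteNormedModule R[i] A := {
  cone : A ;
  cmul : A -> A -> A ;
  cmulA : associative cmul ;
  cmul1r : left_id cone cmul ;
  cmulr1 : right_id cone cmul ;
  cmulDl : left_distributive cmul +%R ;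
  cmulDr : right_distributive cmul +%R ;
  cmulZl : forall (k : R[i]) (a b : A), cmul (k *: a) b = k *: cmul a b ;
  cmulZr : forall (k : R[i]) (a b : A), cmul a (k *: b) = k *: cmul a b ;
  cnormM : forall a b : A, `|cmul a b| <= `|a| * `|b| ;
  star : A -> A ;
  starK : involutive star ;
  starD : forall a b : A, star (a + b) = star a + star b ;
  starZ : forall (k : R[i]) (a : A), star (k *: a) = k^*%R *: star a ;
  starM : forall a b : A, star (cmul a b) = cmul (star b) (star a) ;
  cstar_norm : forall a : A, `|cmul (star a) a| = `|a| ^+ 2 }.

#[short(type="cstarAlgType")]
HB.structure Definition CStarAlgebra (R : realType) :=
  {A of CompleteNormedModule R[i] A & isCStarAlgebra R A}.

Notation "a ** b" := (cmul a b) (at level 40, left associativity) : ring_scope.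

Section Positivity.
Context {R : realType} {A : cstarAlgType R}.
Implicit Types a b : A.

Definition invertible a := exists b, a ** b = cone /\ b ** a = cone.

Definition spectrum a : set R[i] := [set z | ~ invertible (a - z *: cone)].

(* The order of [R[i]] is partial: [0 <= z] says that [z] is real and
   nonnegative. *)
Definition positive a := star a = a /\ forall z, spectrum a z -> 0 <= z.

Definition cstar_le a b := positive (b - a).

End Positivity.

(* Left modules; [inner] is linear in its first variable. *)
HB.mixin Record isHilbertModule (R : realType) (A : cstarAlgType R) H
    of CompleteNormedModule R[i] H := {
  act : A -> H -> H ;
  act1 : forall x, act cone x = x ;
  actM : forall a b x, act (a ** b) x = act a (act b x) ;
  actDl : forall a b x, act (a + b) x = act a x + act b x ;
  actDr : forall a x y, act a (x + y) = act a x + act a y ;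
  actZ : forall (k : R[i]) a x, act (k *: a) x = k *: act a x ;
  inner : H -> H -> A ;
  innerDl : forall x y z, inner (x + y) z = inner x z + inner y z ;
  inner_act : forall a x y, inner (act a x) y = a ** inner x y ;
  inner_star : forall x y, star (inner y x) = inner x y ;
  inner_ge0 : forall x, positive (inner x x) ;
  inner_eq0 : forall x, inner x x = 0 -> x = 0 ;
  hilbert_norm : forall x, `|x| = sqrtC `|inner x x| }.

#[short(type="hilbertModType")]
HB.structure Definition HilbertModule (R : realType) (A : cstarAlgType R) :=
  {H of CompleteNormedModule R[i] H & isHilbertModule R A H}.

Section OperatorFrames.
Context {R : realType} {A : cstarAlgType R} {H : hilbertModType A}.

(* The maps of [adjointable] are automatically A-linear and bounded. *)
Definition adjointable : set (H -> H) :=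
  [set T | exists S : H -> H, forall x y : H,
     inner (T x) y = inner x (S y) :> A].

(* Families over [J : set nat] are given by functions on [nat] whose values
   outside [J] are irrelevant. *)
Definition psums (J : set nat) (a : nat -> A) : nat -> A :=
  fun n => \sum_(0 <= i < n | i \in J) a i.

Definition sq_summable (J : set nat) (T : nat -> H -> H) (x : H) :=
  cvgn (psums J (fun i => inner (T i x) (T i x))).

Definition sq_sum (J : set nat) (T : nat -> H -> H) (x : H) : A :=
  limn (psums J (fun i => inner (T i x) (T i x))).

Definition frame_bounds (J : set nat) (T : nat -> H -> H) (lo up : R) :=
  [/\ 0 < lo, 0 < up &
   forall x : H,
     [/\ sq_summable J T x,
         cstar_le (lo%:C%C *: inner x x) (sq_sum J T x) &
         cstar_le (sq_sum J T x) (up%:C%C *: inner x x)]].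

Definition operator_frame (J : set nat) (T : nat -> H -> H) :=
  exists lo up : R, frame_bounds J T lo up.

End OperatorFrames.

(* Main.v *)
(* The parallelogram law gives <x-y,x-y> <= 2(<x,x> + <y,y>), so each of the
   three sums of squares, of T, U and T - U, is bounded in norm by twice the
   sum of the other two.  Hence (ii) amounts to the norm inequalities
   k |<x,x>| <= |S(x)| <= l |<x,x>| for S(x) = sum <U_i x, U_i x>.  These imply
   the operator inequalities: x |-> <x,x> and S both satisfy
   S(ax) = a S(x) a^*, and if |a p a^*| <= k |a q a^*| for all a, then p <= k q,
   as one sees by taking a = (q + e)^-1/2.  The order theory of A rests on the
   equality of norm and spectral radius for self-adjoint elements, obtained here
   from square roots of 1 - a (|a| < 1) rather than from complex analysis. *)
Require Import Defs.
From mathcomp Require Import all_boot all_order all_algebra.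
From mathcomp Require Import all_classical all_reals all_analysis.
From mathcomp Require Import ring lra.
Import Order.TTheory GRing.Theory Num.Theory.
Import numFieldNormedType.Exports.
Local Open Scope classical_set_scope.
Local Open Scope ring_scope.
Local Open Scope complex_scope.
Set Implicit Arguments.
Unset Strict Implicit.
Unset Printing Implicit Defensive.

(** * Norms as real numbers *)

(** Norms over [R[i]] take values in [R[i]]; passing to the real part loses nothing and makes real
    arithmetic available. *)
Definition rnorm (R : realType) (V : normedModType R[i]) (x : V) : R :=
  complex.Re `|x|.

Section RealNorm.
Context {R : realType} {V : normedModType R[i]}.
Implicit Types (x y : V) (k : R).

Lemma rnormE x : `|x| = (rnorm x)%:C.
Proof. by rewrite /rnorm RRe_real // normr_real. Qed.

Lemma rnorm_ge0 x : 0 <= rnorm x.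
Proof. by rewrite -ler0c -rnormE. Qed.

Lemma rnorm0 : rnorm (0 : V) = 0.
Proof. by rewrite /rnorm normr0. Qed.

Lemma rnorm0_eq0 x : rnorm x = 0 -> x = 0.
Proof. by move=> x0; apply/normr0_eq0; rewrite rnormE x0. Qed.

Lemma rnormN x : rnorm (- x) = rnorm x.
Proof. by rewrite /rnorm normrN. Qed.

Lemma rnormB x y : rnorm (x - y) = rnorm (y - x).
Proof. by rewrite /rnorm distrC. Qed.

Lemma ler_rnormD x y : rnorm (x + y) <= rnorm x + rnorm y.
Proof. by rewrite -lecR rmorphD /= -!rnormE ler_normD. Qed.

Lemma ler_rnormBD x y z : rnorm (x - z) <= rnorm (x - y) + rnorm (y - z).
Proof. by have := ler_rnormD (x - y) (y - z); rewrite addrA subrK. Qed.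

Lemma rnormZ k x : rnorm (k%:C *: x) = `|k| * rnorm x.
Proof.
apply: complexI; rewrite -rnormE normrZ rmorphM /= -rnormE; congr (_ * _).
by rewrite normc_def /= expr0n /= addr0 sqrtr_sqr.
Qed.

Lemma rcvgP (u : nat -> V) (l : V) : u @ \oo --> l <->
  forall e : R, 0 < e -> exists N, forall n, (N <= n)%N -> rnorm (u n - l) < e.
Proof.
split=> [/cvgrPdist_lt ul e e0|ul].
  have e0' : 0 < e%:C by rewrite (ltcR 0 e).
  have [N _ Nu] := ul _ e0'.
  by exists N => n Nn; rewrite rnormB -ltcR -rnormE; apply: Nu.
apply/cvgrPdist_lt => e e0.
(* In the partial order of [R[i]], [0 < e] forces [e] to be real. *)
have eE : e = (complex.Re e)%:C by rewrite RRe_real // gtr0_real.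
rewrite eE (ltcR 0) in e0.
have [N Nu] := ul _ e0; exists N => // n Nn /=.
by rewrite distrC rnormE eE ltcR; apply: Nu.
Qed.

End RealNorm.

(** * Cauchy sequences and Banach's fixed point theorem *)

Section Complete.
Context {R : realType} {V : completeNormedModType R[i]}.
Implicit Types (x y : V) (u : nat -> V).

Lemma rcauchy u : cvgn u ->
  forall e : R, 0 < e -> exists N, forall n m,
    (N <= n)%N -> (N <= m)%N -> rnorm (u n - u m) < e.
Proof.
move=> /(@rcvgP _ V) ul e e0; have e20 : 0 < e / 2 by lra.
have [N Nu] := ul _ e20; exists N => n m Nn Nm.
have := ler_rnormBD (u n) (limn u) (u m).
have := Nu _ Nn; have := Nu _ Nm; rewrite (rnormB (limn u)); lra.
Qed.

Lemma rcauchy_cvg u :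
  (forall e : R, 0 < e -> exists N, forall n m,
    (N <= n)%N -> (n <= m)%N -> rnorm (u m - u n) < e) ->
  cvgn u.
Proof.
move=> uc; apply/cauchy_cvgP/cauchy_ballP => e e0.
have eE : e = (complex.Re e)%:C by rewrite RRe_real // gtr0_real.
rewrite eE (ltcR 0) in e0.
have [N Nu] := uc _ e0.
near_simpl.
exists ([set n | N <= n], [set n | N <= n])%N; first by split; exists N.
move=> [n m] [/= Nn Nm]; rewrite -ball_normE /ball_ /= rnormE eE ltcR.
by have [nm|/ltnW nm] := leqP n m; [rewrite rnormB|]; apply: Nu.
Qed.

(** Banach's theorem on a sequentially closed set [P]; keeping [P] in the conclusion lets closed
    conditions pass to the fixed point. *)
Lemma contraction_fixpoint (f : V -> V) (P : set V) (y0 : V) (q : R) :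
  0 <= q -> q < 1 -> P y0 -> (forall x, P x -> P (f x)) ->
  (forall u l, (forall n, P (u n)) -> u @ \oo --> l -> P l) ->
  (forall x y, P x -> P y -> rnorm (f x - f y) <= q * rnorm (x - y)) ->
  exists2 p, P p & f p = p.
Proof.
move=> q0 q1 P0 Pf Pcl fq.
pose u n := iter n f y0; pose d := rnorm (f y0 - y0).
have uS n : u n.+1 = f (u n) by [].
have Pu n : P (u n) by elim: n => //= n; apply: Pf.
have step n : rnorm (u n.+1 - u n) <= q ^+ n * d.
  elim: n => [|n IH]; first by rewrite expr0 mul1r.
  rewrite exprS -mulrA; apply: (@le_trans _ _ (q * rnorm (u n.+1 - u n))).
    by have := fq _ _ (Pu n.+1) (Pu n); rewrite -!uS.
  exact: ler_wpM2l.
(* The bound is the geometric sum q^n d + ... + q^(n+k-1) d. *)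
have dist n k : rnorm (u (n + k)%N - u n) <=
    q ^+ n * d / (1 - q) * (1 - q ^+ k).
  elim: k => [|k IH]; first by rewrite addn0 subrr rnorm0 expr0 subrr mulr0.
  rewrite addnS; apply: le_trans (ler_rnormBD _ (u (n + k)%N) _) _.
  apply: le_trans (lerD (step _) IH) _.
  rewrite le_eqVlt; apply/orP; left; apply/eqP.
  rewrite exprD exprS; field; lra.
have d0 : 0 <= d by apply: rnorm_ge0.
have geo (e : R) : 0 < e -> exists N, forall n, (N <= n)%N -> q ^+ n < e.
  move=> e0.
  have : (fun n => q ^+ n) @ \oo --> (0 : R).
    by apply: cvg_expr; rewrite ger0_norm.
  move=> /cvgrPdist_lt /(_ _ e0) [N _ Nq]; exists N => n Nn.
  by have := Nq n Nn; rewrite /= sub0r normrN ger0_norm // exprn_ge0.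
have cu : cvgn u.
  apply: rcauchy_cvg => e e0.
  (* The denominator is [d + 1] because [d] may vanish. *)
  have [|N NP] := geo (e * (1 - q) / (d + 1)).
    apply: divr_gt0; [apply: mulr_gt0|]; lra.
  exists N => n m Nn nm; rewrite -(subnKC nm); apply: le_lt_trans (dist _ _) _.
  have := NP _ Nn; rewrite ltr_pdivlMr; last lra.
  move=> qn; have qn0 : 0 <= q ^+ n by rewrite exprn_ge0.
  have qk0 : 0 <= q ^+ (m - n) by rewrite exprn_ge0.
  apply: (@le_lt_trans _ _ (q ^+ n * d / (1 - q))).
    have c0 : 0 <= q ^+ n * d / (1 - q) by rewrite divr_ge0 ?mulr_ge0 //; lra.
    nra.
  rewrite ltr_pdivrMr; nra.
exists (limn u); first exact: Pcl Pu cu.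
(* With l the limit, |f l - l| <= q |l - u_N| + |u_(N+1) - l|, which is arbitrarily small. *)
apply/subr0_eq/rnorm0_eq0/eqP; rewrite eq_le rnorm_ge0 andbT.
apply/ler_addgt0Pl => e e0; rewrite addr0.
have e20 : 0 < e / 2 by lra.
have [N Nu] := (rcvgP u (limn u)).1 cu _ e20.
have := Nu _ (leqnn N); have := Nu _ (leqnSn N).
have := fq _ _ (Pcl _ _ Pu cu) (Pu N).
have := ler_rnormBD (f (limn u)) (u N.+1) (limn u).
have := rnorm_ge0 (limn u - u N); rewrite (rnormB (limn u) (u N)) /=.
nra.
Qed.

End Complete.

(** * Multiplication, involution, inverses and spectrum *)

Section CStarBasics.
Context {R : realType} {A : cstarAlgType R}.
Implicit Types (a b c : A) (k : R) (z : R[i]).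

Lemma cmul0l a : 0 ** a = 0 :> A.
Proof. by have := cmulZl 0 (0 : A) a; rewrite !scale0r. Qed.

Lemma cmul0r a : a ** 0 = 0 :> A.
Proof. by have := cmulZr 0 a (0 : A); rewrite !scale0r. Qed.

Lemma cmulNl a b : (- a) ** b = - (a ** b).
Proof. by rewrite -scaleN1r cmulZl scaleN1r. Qed.

Lemma cmulNr a b : a ** (- b) = - (a ** b).
Proof. by rewrite -scaleN1r cmulZr scaleN1r. Qed.

Lemma cmulBl a b c : (a - b) ** c = a ** c - b ** c.
Proof. by rewrite cmulDl cmulNl. Qed.

Lemma cmulBr a b c : a ** (b - c) = a ** b - a ** c.
Proof. by rewrite cmulDr cmulNr. Qed.

Lemma cmul_scl z a : (z *: cone) ** a = z *: a.
Proof. by rewrite cmulZl cmul1r. Qed.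

Lemma cmul_scr z a : a ** (z *: cone) = z *: a.
Proof. by rewrite cmulZr cmulr1. Qed.

Lemma star0 : star 0 = 0 :> A.
Proof. by have := starZ 0 (0 : A); rewrite conjC0 !scale0r. Qed.

Lemma starN a : star (- a) = - star a.
Proof. by rewrite -scaleN1r starZ rmorphN1 scaleN1r. Qed.

Lemma starB a b : star (a - b) = star a - star b.
Proof. by rewrite starD starN. Qed.

Lemma star1 : star cone = cone :> A.
Proof.
by have := starM (star cone) (cone : A); rewrite starK !cmulr1 starK => <-.
Qed.

Lemma starR k a : star (k%:C *: a) = k%:C *: star a.
Proof. by rewrite starZ conj_Creal // complex_real. Qed.

Lemma star_sc k : star (k%:C *: cone) = k%:C *: cone :> A.
Proof. by rewrite starR star1. Qed.

Lemma rnorm_cmul a b : rnorm (a ** b) <= rnorm a * rnorm b.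
Proof. by rewrite -lecR rmorphM /= -!rnormE cnormM. Qed.

Lemma rnorm_starM a : rnorm (star a ** a) = rnorm a ^+ 2.
Proof. by apply: complexI; rewrite rmorphXn /= -!rnormE cstar_norm. Qed.

(** From |a|^2 = |a^* a| <= |a^*| |a| follows |a| <= |a^*|; the same holds with a^* in place of
    a. *)
Lemma rnorm_star a : rnorm (star a) = rnorm a.
Proof.
have le b : rnorm b <= rnorm (star b).
  have := rnorm_starM b; have := rnorm_cmul (star b) b.
  have := rnorm_ge0 b; have := rnorm_ge0 (star b); nra.
by apply/eqP; rewrite eq_le le -{2}[a]starK le.
Qed.

Lemma rnorm_sqr a : star a = a -> rnorm (a ** a) = rnorm a ^+ 2.
Proof. by move=> sa; rewrite -{1}sa rnorm_starM. Qed.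

(** The C*-identity gives |1|^2 = |1|; equality with 1 would fail in the zero algebra. *)
Lemma rnorm_cone : rnorm (cone : A) <= 1.
Proof.
have := rnorm_sqr star1; rewrite cmul1r; have := rnorm_ge0 (cone : A); nra.
Qed.

Lemma rnorm_sc k : 0 <= k -> rnorm (k%:C *: cone : A) <= k.
Proof.
move=> k0; rewrite rnormZ ger0_norm //; have := rnorm_cone.
have := rnorm_ge0 (cone : A); nra.
Qed.

Lemma cvg_star (u : nat -> A) l : u @ \oo --> l -> (star \o u) @ \oo --> star l.
Proof.
move=> /rcvgP ul; apply/rcvgP => e /ul [N Nu]; exists N => n /Nu.
by rewrite /= -starB rnorm_star.
Qed.

Lemma cvg_cmul (u : nat -> A) l b c : u @ \oo --> l ->
  (fun n => b ** u n ** c) @ \oo --> b ** l ** c.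
Proof.
move=> /rcvgP ul; apply/rcvgP => e e0.
pose d := rnorm b * rnorm c + 1.
have d0 : 0 < d by rewrite ltr_wpDl // mulr_ge0 // rnorm_ge0.
have [N Nu] := ul (e / d) (divr_gt0 e0 d0); exists N => n /Nu.
rewrite -cmulBl -cmulBr ltr_pdivlMr // => h.
apply: le_lt_trans h; apply: le_trans (rnorm_cmul _ _) _.
have := rnorm_cmul b (u n - l); have := rnorm_ge0 (u n - l).
have := rnorm_ge0 b; have := rnorm_ge0 c; rewrite /d; nra.
Qed.

Lemma invertible_of_inverses a b c :
  a ** b = cone -> c ** a = cone -> invertible a.
Proof.
move=> ab ca; exists b; split=> //; suff -> : b = c by [].
by rewrite -[b]cmul1r -ca -cmulA ab cmulr1.
Qed.

(** The maps x |-> 1 + a x and x |-> 1 + x a are contractions of ratio |a|; their fixed points are a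
    right and a left inverse. *)
Lemma invertible_neumann a : rnorm a < 1 -> invertible (cone - a).
Proof.
move=> a1.
have a0 := rnorm_ge0 a.
have [//|//|//|//|//|x y _ _|p _ pE] :=
    @contraction_fixpoint R A (fun x => cone + a ** x) setT 0 (rnorm a).
  by rewrite opprD addrACA subrr add0r -cmulBr; exact: rnorm_cmul.
have [//|//|//|//|//|x y _ _|q _ qE] :=
    @contraction_fixpoint R A (fun x => cone + x ** a) setT 0 (rnorm a).
  by rewrite opprD addrACA subrr add0r -cmulBl mulrC; exact: rnorm_cmul.
have pr : (cone - a) ** p = cone by rewrite cmulBl cmul1r -{1}pE addrK.
have qr : q ** (cone - a) = cone by rewrite cmulBr cmulr1 -{1}qE addrK.
exact: invertible_of_inverses pr qr.
Qed.

Lemma invertibleM a b : invertible a -> invertible b -> invertible (a ** b).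
Proof.
move=> [a' [aa' a'a]] [b' [bb' b'b]]; exists (b' ** a'); split.
  by rewrite -cmulA [b ** _]cmulA bb' cmul1r.
by rewrite -cmulA [a' ** _]cmulA a'a cmul1r.
Qed.

Lemma invertibleZ z a : z != 0 -> invertible a -> invertible (z *: a).
Proof.
move=> z0 [b [ab ba]]; exists (z^-1 *: b).
by rewrite !cmulZl !cmulZr !scalerA ab ba mulfV // mulVf // scale1r.
Qed.

Lemma invertibleN a : invertible a -> invertible (- a).
Proof.
by rewrite -scaleN1r; apply: invertibleZ; rewrite oppr_eq0 oner_eq0.
Qed.

Lemma inverse_star a b :
  a ** b = cone -> b ** a = cone -> star a = a -> star b = b.
Proof.
move=> ab ba sa; have sba : star b ** a = cone.
  by rewrite -{1}sa -starM ab star1.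
by rewrite -[star b]cmulr1 -ab cmulA sba cmul1r.
Qed.

Lemma inverse_comm a b c :
  a ** b = cone -> b ** a = cone -> c ** a = a ** c -> c ** b = b ** c.
Proof.
move=> ab ba ca.
by rewrite -[c ** b]cmul1r -ba -!cmulA [a ** (c ** b)]cmulA -ca -cmulA ab cmulr1.
Qed.

(** If |z| > |a|, then a - z = -z (1 - a/z) is invertible because |a/z| < 1. *)
Lemma spectrum_normc a z : spectrum a z -> Normc.normc z <= rnorm a.
Proof.
move=> nia; rewrite leNgt; apply/negP => az; apply: nia.
have z0 : z != 0.
  apply/eqP => z0; move: az; rewrite z0 Normc.normc0; have := rnorm_ge0 a; lra.
have nz : `|z^-1| = ((Normc.normc z)^-1)%:C.
  by rewrite -Normc.normcV.
have -> : a - z *: cone = - z *: (cone - z^-1 *: a).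
  by rewrite scalerBr !scaleNr scalerA mulfV // scale1r opprK addrC.
apply: invertibleZ; first by rewrite oppr_eq0.
apply: invertible_neumann; rewrite -ltcR -rnormE normrZ nz rnormE.
rewrite -rmorphM /= ltcR mulrC.
rewrite ltr_pdivrMr ?mul1r //; have := rnorm_ge0 a; lra.
Qed.

Lemma cmul_subD_sc a z :
  (a - z *: cone) ** (a + z *: cone) = a ** a - (z * z) *: cone.
Proof.
by rewrite cmulDr !cmulBl cmul_scl !cmul_scr scalerA addrA subrK.
Qed.

(** Translation by i s: x + i (y + s) lies in the spectrum of a + i s, whose squared norm is at most
    |a|^2 + s^2. Hence (y + s)^2 <= |a|^2 + s^2 for every real s, which forces y = 0. *)
Lemma sa_spectrum_Im a z : star a = a -> spectrum a z -> complex.Im z = 0.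
Proof.
case: z => x y sa sz /=.
have key (s : R) : (y + s) ^+ 2 <= rnorm a ^+ 2 + s ^+ 2.
  pose w : R[i] := Complex 0 s.
  have sw : spectrum (a + w *: cone) (Complex x y + w).
    rewrite /spectrum /= scalerDl opprD addrACA; rewrite [X in _ + X]addrC.
    by rewrite [X in _ + X]addrC subrr addr0.
  have := spectrum_normc sw.
  have : rnorm (a + w *: cone) ^+ 2 <= rnorm a ^+ 2 + s ^+ 2.
    rewrite -rnorm_starM starD sa starZ star1.
    have -> : w^*%R = - w.
      by apply/eqP; rewrite eq_complex /= oppr0 !eqxx.
    rewrite scaleNr cmul_subD_sc.
    have -> : w * w = - (s ^+ 2)%:C.
      by apply/eqP; rewrite eq_complex /= !mul0r mulr0 sub0r addr0 oppr0 expr2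
        !eqxx.
    rewrite scaleNr opprK.
    apply: le_trans (ler_rnormD _ _) _; rewrite rnorm_sqr // lerD2l.
    exact/rnorm_sc/sqr_ge0.
  have -> : Normc.normc (Complex x y + w) = Num.sqrt (x ^+ 2 + (y + s) ^+ 2).
    by rewrite /= addr0.
  have := rnorm_ge0 (a + w *: cone); move: (rnorm _) => p p0 pa pq.
  have : Num.sqrt (x ^+ 2 + (y + s) ^+ 2) ^+ 2 <= p ^+ 2.
    by rewrite ler_sqr ?nnegrE ?sqrtr_ge0.
  rewrite sqr_sqrtr ?addr_ge0 ?sqr_ge0 //; have := sqr_ge0 x; lra.
have [//|y0] := eqVneq y 0.
(* This s solves (y + s)^2 = |a|^2 + 1 + s^2. *)
have := key ((rnorm a ^+ 2 + 1 - y ^+ 2) / (2 * y)).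
move: (rnorm a) => n.
have -> : (y + (n ^+ 2 + 1 - y ^+ 2) / (2 * y)) ^+ 2 =
  y ^+ 2 + (n ^+ 2 + 1 - y ^+ 2) + ((n ^+ 2 + 1 - y ^+ 2) / (2 * y)) ^+ 2 by field.
lra.
Qed.

End CStarBasics.

(** * Square roots, and norm against spectral radius for self-adjoint elements *)

Section SelfAdjoint.
Context {R : realType} {A : cstarAlgType R}.
Implicit Types (a b c : A) (k s t x : R) (z : R[i]).

Local Notation sc k := (k%:C *: (cone : A)).

Lemma scD k t : sc (k + t) = sc k + sc t.
Proof. by rewrite rmorphD scalerDl. Qed.

Lemma scN k : sc (- k) = - sc k.
Proof. by rewrite rmorphN scaleNr. Qed.

Lemma scM k t : sc (k * t) = k%:C *: sc t.
Proof. by rewrite rmorphM scalerA. Qed.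

Lemma invertible_gt a t : rnorm a < t -> invertible (sc t - a).
Proof.
move=> at_; rewrite -opprB; apply: invertibleN; apply: contrapT => nia.
have /= := @spectrum_normc _ _ a t%:C nia.
by rewrite expr0n /= addr0 sqrtr_sqr; have := ler_norm t; lra.
Qed.

(* [c = 1 - p], where [p] is the fixed point of [p |-> (a + p^2) / 2]. *)
Lemma sqrt_sub1 a : star a = a -> rnorm a < 1 -> exists c,
  [/\ star c = c, c ** c = cone - a &
      forall b, b ** a = a ** b -> b ** c = c ** b].
Proof.
move=> sa a1; set q := rnorm a; have q0 : 0 <= q := rnorm_ge0 a.
(* The last condition puts p in the bicommutant of a. The radius q keeps the ball stable, as (q +
   q^2) / 2 <= q, and serves as the contraction ratio. *)
pose P : set A := fun p => [/\ star p = p, rnorm p <= q &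
  forall b, b ** a = a ** b -> b ** p = p ** b].
have half2 : `|2^-1| = 2^-1 :> R by rewrite ger0_norm.
have halfD (p : A) : 2^-1%:C *: p + 2^-1%:C *: p = p.
  rewrite -scalerDl -rmorphD /=.
  have -> : 2^-1 + 2^-1 = 1 :> R by lra.
  by rewrite scale1r.
have [//|//|||||p [sp pq pc] pE] := @contraction_fixpoint R A
  (fun p => 2^-1%:C *: (a + p ** p)) P 0 q.
- split; [exact: star0|by rewrite rnorm0|by move=> b _; rewrite cmul0l cmul0r].
- move=> p [sp pq pc]; split.
  + by rewrite starR starD starM sp sa.
  + rewrite rnormZ half2; have := ler_rnormD a (p ** p).
    have := rnorm_cmul p p; have := rnorm_ge0 p; rewrite -/q; nra.
  + move=> b ba; rewrite cmulZr cmulZl cmulDr cmulDl ba cmulA (pc _ ba).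
    by rewrite -cmulA (pc _ ba) cmulA.
- move=> u l Pu ul; split.
  + have su : star \o u = u by apply/funext => n /=; case: (Pu n).
    by have := cvg_star ul; rewrite su => sl; apply: cvg_unique sl ul.
  + apply/ler_addgt0Pl => e e0.
    have [N Nu] := (rcvgP u l).1 ul _ e0.
    have := Nu _ (leqnn N); have [_ + _] := Pu N.
    have := ler_rnormD (l - u N) (u N); rewrite subrK (rnormB l); lra.
  + move=> b ba; have h1 := cvg_cmul (b := b) (c := cone) ul.
    have h2 := cvg_cmul (b := cone) (c := b) ul.
    have uE : (fun n => b ** u n ** cone) = (fun n => cone ** u n ** b).
      apply/funext => n; rewrite cmulr1 cmul1r.
      by have [_ _ ->] := Pu n.
    by rewrite uE cmulr1 in h1; rewrite cmul1r in h2; apply: cvg_unique h1 h2.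
- move=> x y [_ xq _] [_ yq _]; rewrite -scalerBr rnormZ half2.
  (* This splitting of x^2 - y^2 holds without commutation; each term has norm at most q |x - y|. *)
  have -> : a + x ** x - (a + y ** y) = (x - y) ** x + y ** (x - y).
    by rewrite opprD addrACA subrr add0r cmulBl cmulBr addrA subrK.
  have := ler_rnormD ((x - y) ** x) (y ** (x - y)).
  have := rnorm_cmul (x - y) x; have := rnorm_cmul y (x - y).
  have := rnorm_ge0 (x - y); have := rnorm_ge0 x; have := rnorm_ge0 y; nra.
exists (cone - p); split.
- by rewrite starB star1 sp.
- rewrite cmulBr !cmulBl cmul1r cmulr1 cmul1r opprB -addrA; congr (_ + _).
  (* The fixed point equation doubled; it turns (1 - p)^2 into 1 - a. *)
  have : a + p ** p = p + p.
    by rewrite -{3 4}pE halfD.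
  move=> h; have -> : p ** p = p + p - a by rewrite -h addrAC subrr add0r.
  by rewrite [_ - a - p]addrAC addrK addKr.
- by move=> b ba; rewrite cmulBl cmulBr cmul1r cmulr1 (pc _ ba).
Qed.

(** Rescaling: the root is sqrt t times a root of 1 - a/t. *)
Lemma sqrt_sub a t : star a = a -> rnorm a < t -> exists c,
  [/\ star c = c, c ** c = sc t - a &
      forall b, b ** a = a ** b -> b ** c = c ** b].
Proof.
move=> sa a_t; have t0 : 0 < t by apply: le_lt_trans a_t; exact: rnorm_ge0.
have [||c [sc_ cc cc_comm]] := @sqrt_sub1 (t^-1%:C *: a).
- by rewrite starR sa.
- by rewrite rnormZ gtr0_norm ?invr_gt0 // mulrC ltr_pdivrMr // mul1r.
exists ((Num.sqrt t)%:C *: c); split.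
- by rewrite starR sc_.
- rewrite cmulZl cmulZr scalerA -rmorphM /= -expr2 sqr_sqrtr ?ltW // cc scalerBr.
  by rewrite scalerA -rmorphM mulfV ?gt_eqF // scale1r.
- by move=> b ba; rewrite cmulZl cmulZr cc_comm // cmulZl cmulZr ba.
Qed.

(* [a] is the real part of [w = a + i b], and [w^* w = a^2 + b^2]. *)
Lemma rnorm_le_sqr_add a b : star a = a -> star b = b -> a ** b = b ** a ->
  rnorm a ^+ 2 <= rnorm (a ** a + b ** b).
Proof.
move=> sa sb ab; pose i : R[i] := Complex 0 1; pose w := a + i *: b.
have ii : i * i = - 1.
  apply/eqP; rewrite eq_complex /= !mul0r mulr0 mulr1 sub0r addr0 oppr0.
  by rewrite !eqxx.
have sw : star w = a - i *: b.
  rewrite starD sa starZ sb -scaleNr; congr (_ + _ *: _).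
  by apply/eqP; rewrite eq_complex /= oppr0 !eqxx.
have <- : star w ** w = a ** a + b ** b.
  rewrite sw cmulDr !cmulBl !cmulZr !cmulZl ab scalerA ii scaleN1r opprK.
  by rewrite addrA subrK.
rewrite rnorm_starM ler_sqr ?nnegrE ?rnorm_ge0 //.
have aE : 2%:C *: a = w + star w.
  rewrite sw addrACA subrr addr0 -[X in X + _]scale1r.
  rewrite -[X in _ + X]scale1r -scalerDl.
  by rewrite -(rmorph1 (real_complex R)) -rmorphD.
have := ler_rnormD w (star w); rewrite rnorm_star -aE rnormZ ger0_norm //; lra.
Qed.

(* If [n = |a| > s], then [n^2 - a^2] is invertible, so for [t] slightly above
   [n^2] the element [t - a^2] has a square root [c] and still exceeds some
   [2 d > t - n^2]; factoring [t - a^2 - 2 d] as [e^2] with [e] commuting with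
   [a] gives [n^2 <= |a^2 + e^2| = t - 2 d < n^2]. *)
Lemma sa_rnorm_le a s : star a = a -> 0 <= s ->
  (forall x, s < `|x| -> invertible (a - sc x)) -> rnorm a <= s.
Proof.
move=> sa s0 ia; rewrite leNgt; apply/negP => sn; set n := rnorm a in sn.
pose b := a ** a; have sb : star b = b by rewrite starM sa.
have nb : rnorm b = n ^+ 2 by rewrite rnorm_sqr.
have n0 : 0 < n by apply: le_lt_trans sn.
(* Up to sign this is (a - n)(a + n), and both n and -n exceed s in modulus. *)
have [g [bg gb]] : invertible (sc (n ^+ 2) - b).
  rewrite -opprB; apply: invertibleN; rewrite expr2 rmorphM /= -cmul_subD_sc.
  apply: invertibleM; first by apply: ia; rewrite gtr0_norm.
  by rewrite -[sc n]opprK -scN; apply: ia; rewrite normrN gtr0_norm.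
pose v := (n ^+ 2)^-1; have v0 : 0 < v by rewrite invr_gt0 exprn_gt0.
have g0 := rnorm_ge0 g.
(* The two summands of [C] give d |g| <= 1/4, which controls [h], and d <= n^2 / 4, which keeps t -
   2 d nonnegative. *)
pose C := rnorm g + v; have C0 : 0 < C by rewrite /C; lra.
pose d := (4 * C)^-1; have d0 : 0 < d by rewrite invr_gt0; lra.
have dC : d * C = 4^-1 by rewrite /d; field; rewrite gt_eqF.
have dg : d * rnorm g <= 4^-1 by rewrite -dC ler_pM2l // /C; lra.
have dn : d <= 4^-1 * n ^+ 2.
  rewrite -ler_pdivrMr ?exprn_gt0 // -dC ler_pM2l // /C -/v; lra.
pose t := n ^+ 2 + d; have bt : rnorm b < t by rewrite nb /t; lra.
have [h [bh hb]] := invertible_gt bt.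
(* Resolvent identity; it yields |h| <= |g| + |h| / 4, hence |h| < 2 C. *)
have hE : h = g - d%:C *: (h ** g).
  have hg : h ** (sc (n ^+ 2) - b) = cone - d%:C *: h.
    rewrite -(cmul_scr d%:C) -[X in _ = X - _]hb -cmulBr; congr (_ ** _).
    by rewrite /t scD [X in _ = X]addrAC addrK.
  by rewrite -{1}[h]cmulr1 -bg cmulA hg cmulBl cmul1r cmulZl.
have nh : rnorm h < 2 * C.
  have : rnorm h <= rnorm g + d * (rnorm h * rnorm g).
    rewrite {1}hE; apply: le_trans (ler_rnormD _ _) _.
    rewrite rnormN rnormZ gtr0_norm // lerD2l ler_pM2l //; exact: rnorm_cmul.
  have := rnorm_ge0 h; have : rnorm g <= C by rewrite /C; lra.
  nra.
have sh : star h = h by apply: inverse_star bh hb _; rewrite starB star_sc sb.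
have [c [sc_ cc cC]] := sqrt_sub sb bt.
(* Since [h] is the inverse of t - b, multiplying t - b by 1 - h / (2 C) subtracts 1 / (2 C) = 2 d
   from it. *)
have [||k [sk kk kC]] := @sqrt_sub1 ((2 * C)^-1%:C *: h).
- by rewrite starR sh.
- rewrite rnormZ gtr0_norm ?invr_gt0; last lra.
  by rewrite mulrC ltr_pdivrMr ?mul1r //; lra.
have commh (x : A) : x ** b = b ** x -> x ** h = h ** x.
  move=> xb; apply: inverse_comm bh hb _.
  by rewrite cmulBr cmulBl cmul_scl cmul_scr xb.
have commk (x : A) : x ** b = b ** x -> x ** k = k ** x.
  by move=> /commh xh; apply: kC; rewrite cmulZr cmulZl xh.
have ab : a ** b = b ** a by rewrite /b cmulA.
have ck : c ** k = k ** c by apply: commk; rewrite (cC b).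
pose e := c ** k.
have se : star e = e by rewrite starM sc_ sk -ck.
have ae : a ** e = e ** a.
  by rewrite /e cmulA (cC _ ab) -cmulA (commk _ ab) cmulA.
have ee : e ** e = sc t - b - sc (2 * C)^-1.
  have -> : e ** e = (c ** c) ** (k ** k).
    by rewrite /e cmulA -[c ** k ** c]cmulA -ck !cmulA.
  by rewrite cc kk cmulBr cmulr1 cmulZr bh.
have := rnorm_le_sqr_add sa se ae.
have -> : a ** a + e ** e = sc (t - (2 * C)^-1).
  by rewrite ee (scD t) scN addrA [a ** a + _]addrC subrK.
have -> : (2 * C)^-1 = 2 * d by rewrite /d; field; rewrite gt_eqF.
have td : 0 <= t - 2 * d.
  by rewrite /t; have := sqr_ge0 n; lra.
have := rnorm_sc (A := A) td; rewrite -/n /t; lra.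
Qed.

End SelfAdjoint.

(** * The positive cone and its order *)

Section Positive.
Context {R : realType} {A : cstarAlgType R}.
Implicit Types (a b c p q y : A) (k s t x : R) (z : R[i]).

Local Notation sc k := (k%:C *: (cone : A)).

(** The spectrum of a self-adjoint element is real, so only negative reals have to be excluded. *)
Lemma positive_intro a : star a = a ->
  (forall x, 0 < x -> invertible (a + sc x)) -> positive a.
Proof.
move=> sa ia; split => // -[x y] sz.
have /= y0 := sa_spectrum_Im sa sz; subst y.
rewrite (lecR 0 x) leNgt; apply/negP => x0; apply: sz.
have -> : (Complex x 0) = - (- x)%:C by rewrite -rmorphN opprK.
by rewrite scaleNr opprK; apply: ia; rewrite oppr_gt0.
Qed.

Lemma positive_invertible a x : positive a -> 0 < x -> invertible (a + sc x).
Proof.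
move=> [_ pa] x0; apply: contrapT => nia.
have : spectrum a (- x)%:C by rewrite /spectrum /= scN opprK.
by move=> /pa; rewrite (lecR 0 (- x)) oppr_ge0 leNgt x0.
Qed.

(** With [dist_positive], this makes positivity a norm condition. By [sa_rnorm_le] it suffices to
    invert t - a - x for |x| > t: for x < 0 because t - x > |a|, for x > t because a + (x - t) is
    invertible. *)
Lemma positive_dist a t : positive a -> rnorm a <= t -> rnorm (sc t - a) <= t.
Proof.
move=> pa at_; have a0 := rnorm_ge0 a; have sa := pa.1.
have t0 : 0 <= t by lra.
apply: sa_rnorm_le => // [|x]; first by rewrite starB star_sc sa.
rewrite addrAC -scN -scD => tx.
have [x0|x0] := ltP x 0.
  by apply: invertible_gt; lra.
rewrite ger0_norm // in tx.
rewrite -opprB -scN; apply: invertibleN; apply: positive_invertible => //; lra.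
Qed.

Lemma dist_positive a t : star a = a -> rnorm (sc t - a) <= t -> positive a.
Proof.
move=> sa at_; apply: positive_intro => // x x0.
have -> : a + sc x = sc (t + x) - (sc t - a).
  rewrite scD opprB [sc t + _]addrC -addrA [sc t + _]addrCA subrr addr0.
  exact: addrC.
apply: invertible_gt; lra.
Qed.

(** The norm criterion at |a| + |b| reduces this to the triangle inequality. *)
Lemma positiveD a b : positive a -> positive b -> positive (a + b).
Proof.
move=> pa pb; apply: (@dist_positive _ (rnorm a + rnorm b)).
  by rewrite starD pa.1 pb.1.
rewrite scD opprD addrACA; apply: le_trans (ler_rnormD _ _) _.
by apply: lerD; apply: positive_dist.
Qed.

Lemma positive_sc k : 0 <= k -> positive (sc k).
Proof.
move=> k0; apply: (@dist_positive _ k); first exact: star_sc.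
by rewrite subrr rnorm0.
Qed.

Lemma positive0 : positive (0 : A).
Proof. by have := positive_sc (lexx 0); rewrite scale0r. Qed.

Lemma positiveZ k a : 0 <= k -> positive a -> positive (k%:C *: a).
Proof.
rewrite le_eqVlt => /orP[/eqP <-|k0] pa.
  by rewrite scale0r; exact: positive0.
apply: positive_intro; first by rewrite starR pa.1.
move=> x x0; have -> : k%:C *: a + sc x = k%:C *: (a + sc (x / k)).
  by rewrite scalerDr -scM mulrC divfK // gt_eqF.
apply: invertibleZ; first by rewrite eq_complex /= eqxx andbT gt_eqF.
by apply: positive_invertible => //; apply: divr_gt0.
Qed.

Lemma positive_sc_sub a k : star a = a -> rnorm a <= k -> positive (sc k - a).
Proof.
move=> sa ak; apply: (@dist_positive _ k); first by rewrite starB star_sc sa.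
by rewrite opprB addrCA subrr addr0.
Qed.

Lemma positive_rnorm_le a k : 0 <= k -> positive a -> positive (sc k - a) ->
  rnorm a <= k.
Proof.
move=> k0 pa pka; apply: sa_rnorm_le => //; first exact: pa.1.
move=> x kx; have [x0|x0] := ltP x 0.
  rewrite ltr0_norm // in kx.
  by rewrite -scN; apply: positive_invertible => //; rewrite oppr_gt0.
rewrite ger0_norm // in kx.
have -> : a - sc x = - ((sc k - a) + sc (x - k)).
  by rewrite scD scN [_ - a]addrC [sc x - _]addrC addrA addrK opprD opprK.
by apply: invertibleN; apply: positive_invertible => //; rewrite subr_gt0.
Qed.

(** Here 0 <= a <= b <= |b|, so the spectrum of a lies in [0, |b|]. *)
Lemma cstar_le_rnorm a b : positive a -> cstar_le a b -> rnorm a <= rnorm b.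
Proof.
move=> pa ab; have sb : star b = b.
  by rewrite -[b](subrK a) starD ab.1 pa.1.
apply: positive_rnorm_le => //; first exact: rnorm_ge0.
have := positiveD (positive_sc_sub sb (lexx _)) ab.
by rewrite addrA subrK.
Qed.

Lemma positive_cvg (u : nat -> A) l : (forall n, positive (u n)) ->
  u @ \oo --> l -> positive l.
Proof.
move=> pu ul; have sl : star l = l.
  have su : star \o u = u by apply/funext => n /=; case: (pu n).
  by have := cvg_star ul; rewrite su => sul; apply: cvg_unique sul ul.
apply: positive_intro => // x x0; have x20 : 0 < x / 2 by lra.
have [N /(_ _ (leqnn N)) /ltW uN] := (rcvgP u l).1 ul _ x20.
(* The bracket is positive because |u_N - l| < x / 2. *)
have -> : l + sc x = (u N + (sc (x / 2) - (u N - l))) + sc (x / 2).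
  rewrite opprB [_ + (l - _)]addrCA [u N + _]addrCA [u N + _]addrCA subrr addr0.
  by rewrite -addrA -scD; congr (_ + sc _); lra.
apply: positive_invertible x20; apply: positiveD => //.
by apply: positive_sc_sub => //; rewrite starB sl (pu N).1.
Qed.

(** For x > 0, a^2 + x = (a - i sqrt x)(a + i sqrt x), and the spectrum of a contains no nonreal
    number. *)
Lemma positive_sqr a : star a = a -> positive (a ** a).
Proof.
move=> sa; apply: positive_intro; first by rewrite starM sa.
move=> x x0; pose w : R[i] := Complex 0 (Num.sqrt x).
have -> : a ** a + sc x = (a - w *: cone) ** (a + w *: cone).
  rewrite cmul_subD_sc -scaleNr; congr (_ + _ *: _).
  apply/eqP; rewrite eq_complex /= !mul0r mulr0 addr0 sub0r opprK oppr0 eqxx andbT.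
  by rewrite -expr2 sqr_sqrtr // ltW.
have sx : 0 < Num.sqrt x by rewrite sqrtr_gt0.
apply: invertibleM.
  by apply: contrapT => /(sa_spectrum_Im sa) /= h; rewrite h ltxx in sx.
rewrite -[X in a + X]opprK -scaleNr.
apply: contrapT => /(sa_spectrum_Im sa) /= /eqP.
by rewrite oppr_eq0 gt_eqF.
Qed.

Lemma positive_invertible_sub a : positive a -> invertible a ->
  exists2 k, 0 < k & positive (a - sc k).
Proof.
move=> pa [g [ag ga]]; pose k := (rnorm g + 1)^-1; have g0 := rnorm_ge0 g.
have k0 : 0 < k by rewrite invr_gt0; lra.
exists k => //; apply: positive_intro; first by rewrite starB star_sc pa.1.
move=> x x0; rewrite -addrA -scN -scD; have [kx|xk] := ltP k x.
  by apply: positive_invertible => //; lra.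
(* The choice of [k] gives (k - x) |g| < 1, so the second factor has a Neumann inverse. *)
have -> : a + sc (- k + x) = a ** (cone - (k - x)%:C *: g).
  by rewrite cmulBr cmulr1 cmulZr ag -scN opprB [- k + x]addrC.
apply: invertibleM; first by exists g.
apply: invertible_neumann; rewrite rnormZ ger0_norm ?subr_ge0 //.
have : k * (rnorm g + 1) = 1 by rewrite mulVf // gt_eqF //; lra.
nra.
Qed.

(* [b ** y ** b + x = b ** (y + x b^-2) ** b], and the middle factor exceeds a
   positive scalar since [b^-2] does. *)
Lemma positive_conj y b : positive y -> star b = b -> invertible b ->
  positive (b ** y ** b).
Proof.
move=> py sb ib; have [c [bc cb]] := ib.
have sc_ := inverse_star bc cb sb.
have [] := @positive_invertible_sub (c ** c) (positive_sqr sc_).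
  by apply: invertibleM; exists b.
move=> k k0 pk; apply: positive_intro.
  by rewrite !starM sb py.1 cmulA.
move=> x x0.
have -> : b ** y ** b + sc x = b ** (y + x%:C *: (c ** c)) ** b.
  rewrite cmulDr cmulDl cmulZr cmulZl; congr (_ + _ *: _).
  by rewrite cmulA bc cmul1r cb.
apply: invertibleM => //; apply: invertibleM => //.
have -> : y + x%:C *: (c ** c) = (y + x%:C *: (c ** c - sc k)) + sc (x * k).
  by rewrite scalerBr scM addrA subrK.
apply: positive_invertible; last exact: mulr_gt0.
by apply: positiveD => //; apply: positiveZ => //; exact: ltW.
Qed.

(** Write q + x = t - r with t = |q| + x and r = |q| - q, so that |r| <= |q| < t. The root is
    invertible because its square is. *)
Lemma positive_sqrt_inv q x : positive q -> 0 < x -> exists b c,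
  [/\ star b = b, star c = c, b ** c = cone, c ** b = cone & b ** b = q + sc x].
Proof.
move=> pq x0; pose t := rnorm q + x; pose r := sc (rnorm q) - q.
have rt : rnorm r < t.
  by have := positive_dist pq (lexx _); rewrite -/r /t; lra.
have [|b [sb bb _]] := @sqrt_sub _ _ r t _ rt.
  by rewrite starB star_sc pq.1.
have {}bb : b ** b = q + sc x.
  by rewrite bb /t scD /r opprB addrC addrA subrK.
have [g [bg gb]] := positive_invertible pq x0; rewrite -bb in bg gb.
have [c [bc cb]] : invertible b.
  apply: (@invertible_of_inverses _ _ _ (b ** g) (g ** b)).
    by rewrite cmulA.
  by rewrite -cmulA.
by exists b, c; split => //; exact: inverse_star bc cb sb.
Qed.

(* Applying the hypothesis to [a = (q + e)^-1/2], which makes [a q a <= 1],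
   and conjugating back gives [p <= K (q + e)]. *)
Lemma cstar_le_of_rnorm p q k : star p = p -> positive q -> 0 < k ->
  (forall a, star a = a -> rnorm (a ** p ** a) <= k * rnorm (a ** q ** a)) ->
  cstar_le p (k%:C *: q).
Proof.
move=> sp pq k0 pqk; apply: positive_intro.
  by rewrite starB starR pq.1 sp.
(* Taking e = x / (2 k) makes k e half of x; the other half provides invertibility at the end. *)
move=> x x0; have e0 : 0 < x / 2 / k by rewrite !divr_gt0.
have [b [c [sb sc_ bc cb bb]]] := positive_sqrt_inv pq e0.
have ic : invertible c by exists b.
have ib : invertible b by exists c.
have cqc : rnorm (c ** q ** c) <= 1.
  apply: positive_rnorm_le => //; first exact: positive_conj.
  have -> : sc 1 - c ** q ** c = c ** sc (x / 2 / k) ** c.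
    have -> : sc (x / 2 / k) = b ** b - q by rewrite bb addrC addKr.
    by rewrite cmulBr cmulBl cmulA cb cmul1r bc scale1r.
  by apply: positive_conj => //; apply: positive_sc; exact: ltW.
have cpc : positive (sc k - c ** p ** c).
  apply: positive_sc_sub; first by rewrite !starM sc_ sp cmulA.
  by apply: le_trans (pqk _ sc_) _; rewrite -[leRHS]mulr1 ler_pM2l.
(* Conjugating k - c p c >= 0 by b gives k (q + e) - p >= 0. *)
have := positive_conj cpc sb ib.
rewrite cmulBr cmulBl cmul_scr cmulZl bb.
have -> : b ** (c ** p ** c) ** b = p.
  by rewrite !cmulA bc cmul1r -cmulA cb cmulr1.
rewrite scalerDr -scM mulrC divfK ?gt_eqF // addrAC => h.
have -> : k%:C *: q - p + sc x = k%:C *: q - p + sc (x / 2) + sc (x / 2).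
  by rewrite -[RHS]addrA -scD; congr (_ + sc _); lra.
by apply: positive_invertible => //; lra.
Qed.

End Positive.

(** * Norm-convergent series of positive elements *)

Section Series.
Context {R : realType} {A : cstarAlgType R}.
Implicit Types (a b c : nat -> A) (J : set nat).

Lemma positive_sum (I : Type) (r : seq I) (P : pred I) (F : I -> A) :
  (forall i, P i -> positive (F i)) -> positive (\sum_(i <- r | P i) F i).
Proof.
move=> pF; apply: big_ind => //; [exact: positive0|exact: positiveD].
Qed.

Lemma psumsB J a n m : (n <= m)%N ->
  psums J a m - psums J a n = \sum_(n <= i < m | i \in J) a i.
Proof. by move=> nm; rewrite /psums (big_cat_nat _ nm) //= addrAC subrr add0r. Qed.

Lemma psums_sub J a b : psums J (fun i => b i - a i) = psums J b \- psums J a.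
Proof. by apply/funext => n; rewrite /psums sumrB. Qed.

Lemma psums_positive_lim J a : (forall i, positive (a i)) -> cvgn (psums J a) ->
  positive (limn (psums J a)).
Proof. by move=> pa; apply: positive_cvg => n; apply: positive_sum. Qed.

(** Blocks of the two series inherit the order and the norm is monotone on positive elements, so the
    Cauchy property passes from b to a. The limits compare because the cone is closed. *)
Lemma psums_comparison J a b : (forall i, positive (a i)) ->
  (forall i, cstar_le (a i) (b i)) -> cvgn (psums J b) ->
  cvgn (psums J a) /\ rnorm (limn (psums J a)) <= rnorm (limn (psums J b)).
Proof.
move=> pa ab cb.
have ca : cvgn (psums J a).
  apply: rcauchy_cvg => e e0; have [N Nb] := rcauchy cb e0.
  exists N => n m Nn nm; apply: le_lt_trans (Nb _ _ (leq_trans Nn nm) Nn).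
  rewrite !psumsB //; apply: cstar_le_rnorm; first exact: positive_sum.
  by rewrite /cstar_le -sumrB; apply: positive_sum => i _; exact: ab.
split => //; apply: cstar_le_rnorm; first exact: psums_positive_lim.
apply: (@positive_cvg _ _ (psums J (fun i => b i - a i))).
  by move=> n; apply: positive_sum => i _; exact: ab.
by rewrite psums_sub; exact: cvgB.
Qed.

Lemma psums_comparison2 J a b c : (forall i, positive (a i)) ->
  (forall i, cstar_le (a i) (2%:C *: (b i + c i))) ->
  cvgn (psums J b) -> cvgn (psums J c) ->
  cvgn (psums J a) /\ rnorm (limn (psums J a)) <=
    2 * (rnorm (limn (psums J b)) + rnorm (limn (psums J c))).
Proof.
move=> pa abc cb cc.
have psE : psums J (fun i => 2%:C *: (b i + c i)) =
    (fun n => 2%:C *: (psums J b n + psums J c n)).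
  by apply/funext => n; rewrite /psums -big_split /= scaler_sumr.
have l : psums J (fun i => 2%:C *: (b i + c i)) @ \oo -->
    2%:C *: (limn (psums J b) + limn (psums J c)).
  by rewrite psE; apply: cvgZl_tmp; exact: cvgD.
have [|ca le] := @psums_comparison J _ _ pa abc; first exact: cvgP l.
split => //; apply: le_trans le _; rewrite (cvg_lim _ l) // rnormZ ger0_norm //.
by rewrite ler_pM2l //; exact: ler_rnormD.
Qed.

End Series.

(** * Sums of squares in Hilbert modules *)

Section HilbertModules.
Context {R : realType} {A : cstarAlgType R} {H : hilbertModType A}.
Implicit Types (x y z : H) (a b : A).

Local Notation "<[ x , y ]>" := (inner x y : A).

Lemma innerDr x y z : <[x, y + z]> = <[x, y]> + <[x, z]>.
Proof. by rewrite -!(inner_star x) innerDl starD. Qed.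

Lemma innerNl x y : <[- x, y]> = - <[x, y]>.
Proof.
have inner0 : <[0, y]> = 0.
  by apply: (@addrI _ <[0, y]>); rewrite -innerDl !addr0.
by apply/eqP; rewrite -addr_eq0 -innerDl addNr inner0.
Qed.

Lemma innerNr x y : <[x, - y]> = - <[x, y]>.
Proof. by rewrite -!(inner_star x) innerNl starN. Qed.

Lemma inner_actr a x y : <[x, act a y]> = <[x, y]> ** star a.
Proof. by rewrite -!(inner_star x) inner_act starM. Qed.

Lemma inner_parallelogram x y : <[x + y, x + y]> + <[x - y, x - y]> =
  2%:C *: (<[x, x]> + <[y, y]>).
Proof.
have twice (a : A) : 2%:C *: a = a + a.
  by rewrite (natrD _ 1 1) rmorphD /= scalerDl scale1r.
rewrite !innerDl !innerDr !innerNl !innerNr opprK scalerDr !twice addrACA.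
by rewrite [X in X + _]addrACA [X in _ + X]addrACA !subrr addr0 add0r.
Qed.

Lemma inner_sub_le x y :
  cstar_le <[x - y, x - y]> (2%:C *: (<[x, x]> + <[y, y]>)).
Proof. by rewrite /cstar_le -inner_parallelogram addrK; exact: inner_ge0. Qed.

Lemma inner_add_le x y :
  cstar_le <[x + y, x + y]> (2%:C *: (<[x, x]> + <[y, y]>)).
Proof.
by rewrite /cstar_le -inner_parallelogram addrC addKr; exact: inner_ge0.
Qed.

Lemma inner_inj x y : (forall z, <[x, z]> = <[y, z]>) -> x = y.
Proof.
move=> xy; apply/subr0_eq/(@inner_eq0 R A).
by rewrite innerDl innerNl xy subrr.
Qed.

(** Both sides have inner product a <x, S z> with every z, where S is an adjoint of T. *)
Lemma adjointable_act (T : H -> H) a x :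
  adjointable T -> T (act a x) = act a (T x).
Proof. by move=> [S TS]; apply: inner_inj => z; rewrite TS !inner_act TS. Qed.

Variable J : set nat.
Implicit Types (T U : nat -> H -> H).

(** Replacing x by a x conjugates every term by a, and conjugation is continuous. This supplies the
    conjugates that [cstar_le_of_rnorm] tests. *)
Lemma sq_sum_act U a x : (forall i, J i -> adjointable (U i)) ->
  sq_summable J U x -> sq_sum J U (act a x) = a ** sq_sum J U x ** star a.
Proof.
move=> hU sU; apply: cvg_lim => //.
have -> : psums J (fun i => <[U i (act a x), U i (act a x)]>) =
    (fun n => a ** psums J (fun i => <[U i x, U i x]>) n ** star a).
  apply/funext => n; rewrite /psums.
  rewrite (big_morph (fun b => a ** b ** star a) (id1 := 0) (op1 := +%R)).
  - apply: eq_bigr => i /set_mem Ji.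
    by rewrite adjointable_act ?inner_act ?inner_actr ?cmulA //; exact: hU.
  - by move=> y z; rewrite cmulDr cmulDl.
  - by rewrite cmul0r cmul0l.
exact: cvg_cmul.
Qed.

Lemma sq_sum_ge0 U x : sq_summable J U x -> positive (sq_sum J U x).
Proof. by apply: psums_positive_lim => i; exact: inner_ge0. Qed.

(** The two signs cover all three uses: D = T - U, T = D + U and U = T - D. *)
Lemma sq_sum_le T U V x :
  (forall i, V i x = T i x - U i x \/ V i x = T i x + U i x) ->
  sq_summable J T x -> sq_summable J U x ->
  sq_summable J V x /\
  rnorm (sq_sum J V x) <= 2 * (rnorm (sq_sum J T x) + rnorm (sq_sum J U x)).
Proof.
move=> VE; apply: psums_comparison2 => i; first exact: inner_ge0.
by case: (VE i) => ->; [exact: inner_sub_le|exact: inner_add_le].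
Qed.

Lemma frame_bounds_rnorm T lo up x : frame_bounds J T lo up ->
  lo * rnorm <[x, x]> <= rnorm (sq_sum J T x) /\
  rnorm (sq_sum J T x) <= up * rnorm <[x, x]>.
Proof.
move=> [lo0 up0 /(_ x)[sT loT Tup]]; split.
  rewrite -[lo]gtr0_norm // -rnormZ; apply: cstar_le_rnorm loT.
  by apply: positiveZ; [exact: ltW|exact: inner_ge0].
by rewrite -[up]gtr0_norm // -rnormZ; apply: cstar_le_rnorm Tup; exact: sq_sum_ge0.
Qed.

(** The norm inequalities at all points a x, with a self-adjoint, are the hypotheses of
    [cstar_le_of_rnorm] for <x,x> and the sum of squares. *)
Lemma frame_bounds_of_rnorm U k l : (forall i, J i -> adjointable (U i)) ->
  0 < k -> 0 < l ->
  (forall x, [/\ sq_summable J U x, rnorm <[x, x]> <= k * rnorm (sq_sum J U x) &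
    rnorm (sq_sum J U x) <= l * rnorm <[x, x]>]) ->
  frame_bounds J U k^-1 l.
Proof.
move=> hU k0 l0 hn; split => // [|x]; first by rewrite invr_gt0.
have [sU _ _] := hn x; split => //.
- have : cstar_le <[x, x]> (k%:C *: sq_sum J U x).
    apply: cstar_le_of_rnorm => //; first exact: inner_star.
      exact: sq_sum_ge0.
    move=> a sa; have [_ + _] := hn (act a x).
    by rewrite sq_sum_act // inner_act inner_actr cmulA sa.
  move=> /(@positiveZ R A k^-1); rewrite scalerBr scalerA -rmorphM mulVf ?gt_eqF //.
  by rewrite scale1r; apply; rewrite invr_ge0 ltW.
- apply: cstar_le_of_rnorm => //; [|exact: inner_ge0|].
    by case: (sq_sum_ge0 sU).
  move=> a sa; have [_ _] := hn (act a x).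
  by rewrite sq_sum_act // inner_act inner_actr cmulA sa.
Qed.

End HilbertModules.

(** * Perturbation of operator frames, by comparison of norms *)

Theorem theorem3p4 (R : realType) (A : cstarAlgType R) (H : hilbertModType A)
    (J : set nat) (T U : nat -> H -> H) (lo up : R)
    (hT : forall i, J i -> adjointable (T i))
    (hU : forall i, J i -> adjointable (U i))
    (hframe : frame_bounds J T lo up) :
  operator_frame J U <->
  exists M : R, 0 < M /\
    forall x : H,
      let D := fun i y => T i y - U i y in
      [/\ sq_summable J D x, sq_summable J T x, sq_summable J U x &
          `|sq_sum J D x|
            <= M%:C%C * Num.min `|sq_sum J T x| `|sq_sum J U x| ].
Proof.
have [lo0 up0 sT] := hframe; split=> [[lo' [up' hframe']]|[M [M0 hM]]].
  have [lo'0 up'0 sU] := hframe'.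
  have q0 : 0 < up' / lo by exact: divr_gt0.
  have q'0 : 0 < up / lo' by exact: divr_gt0.
  (* The ratios bound the [U] sum by the [T] sum and conversely; including both serves either value
     of the minimum. *)
  pose M := 2 * (1 + up' / lo + up / lo'); exists M.
  split; first by rewrite /M; lra.
  move=> x D; have [sTx _ _] := sT x; have [sUx _ _] := sU x.
  have [|sD leD] := @sq_sum_le _ _ _ J T U D x _ sTx sUx; first by left.
  split => //; have [Tlo Tup] := frame_bounds_rnorm x hframe.
  have [Ulo Uup] := frame_bounds_rnorm x hframe'.
  have UT : rnorm (sq_sum J U x) <= up' / lo * rnorm (sq_sum J T x).
    by apply: le_trans Uup _; rewrite -mulrA ler_pM2l // ler_pdivlMl.
  have TU : rnorm (sq_sum J T x) <= up / lo' * rnorm (sq_sum J U x).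
    by apply: le_trans Tup _; rewrite -mulrA ler_pM2l // ler_pdivlMl.
  have T0 := rnorm_ge0 (sq_sum J T x); have U0 := rnorm_ge0 (sq_sum J U x).
  rewrite minEle; case: ifP => _; rewrite !rnormE -rmorphM lecR /M; nra.
(* Since T = D + U and U = T - D, and the sum for D is at most M times either other sum, the
   parallelogram bound gives 2 (M + 1). *)
have sq_summ x : [/\ sq_summable J U x,
    rnorm (sq_sum J T x) <= 2 * (M + 1) * rnorm (sq_sum J U x) &
    rnorm (sq_sum J U x) <= 2 * (M + 1) * rnorm (sq_sum J T x)].
  have [sD sTx sUx leD] := hM x.
  have [|_ leT] := @sq_sum_le _ _ _ J _ U T x _ sD sUx.
    by move=> i; right; rewrite subrK.
  have [|_ leU] := @sq_sum_le _ _ _ J T _ U x _ sTx sD.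
    by move=> i; left; rewrite subKr.
  have [leDT leDU] : rnorm (sq_sum J (fun i y => T i y - U i y) x) <=
        M * rnorm (sq_sum J T x) /\
      rnorm (sq_sum J (fun i y => T i y - U i y) x) <= M * rnorm (sq_sum J U x).
    move: leD; rewrite !rnormE minEle lecR.
    have [TU|UT] := leP (rnorm (sq_sum J T x)) (rnorm (sq_sum J U x));
      rewrite -rmorphM lecR => h; split => //; apply: le_trans h _.
      by rewrite ler_pM2l.
    by rewrite ler_pM2l // ltW.
  split => //; lra.
(* These come from chaining the comparison of [T] and [U] with the bounds [lo] and [up] of [T]. *)
exists (2 * (M + 1) / lo)^-1, (2 * (M + 1) * up).
have M1 : 0 < 2 * (M + 1) by lra.
apply: frame_bounds_of_rnorm => // [||x]; [exact: divr_gt0|exact: mulr_gt0|].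
have [sU TU UT] := sq_summ x; have [Tlo Tup] := frame_bounds_rnorm x hframe.
split => //.
  by rewrite mulrAC ler_pdivlMr // mulrC; apply: le_trans Tlo _.
by apply: le_trans UT _; rewrite -[leRHS]mulrA ler_pM2l.
Qed.
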